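(* Let $k\geq 2$ and let $T$ be a $(2k+1)$-strong tournament such that every arc of $T$ has a 2-bypass (i.e. for every arc $uv$ of $T$ there is a vertex $w$ with $uw$ and $wv$ arcs of $T$). Then $T$ is $(k+1)^{*}$-strongly connected.
   Context: A tournament is a digraph in which each pair of distinct vertices is joined by exactly one arc. A digraph is $m$-strong if it has more than $m$ vertices and remains strongly connected after deleting any set of fewer than $m$ vertices. For distinct vertices $u,v$ of a digraph $D$, a strong $k^{*}$-container between $u$ and $v$ is a set of $k$ internally disjoint paths that are either all $(u,v)$-paths or all $(v,u)$-paths, whose union contains every vertex of $D$. $D$ is $k^{*}$-strongly connected if there is a strong $k^{*}$-container between every two distinct vertices of $D$. *)

(* Defs.v *)
From mathcomp Require Import all_boot.
Set Implicit Arguments. Unset Strict Implicit. Unset Printing Implicit Defensive.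

Section Digraphs.
Variable T : finType.
Implicit Types (e : rel T) (u v x : T) (p : seq T).

Definition is_tournament e : Prop :=
  (forall x, ~~ e x x) /\ (forall u v, u != v -> e u v != e v u).

Definition is_dipath e u v p : bool :=
  [&& path e u p, last u p == v & uniq (u :: p)].

(* Internal vertices of the path u :: p (drop u and the final vertex). *)
Definition interior p : seq T := take (size p).-1 p.

Definition strong_without e (S : {set T}) : Prop :=
  forall x y, x \notin S -> y \notin S ->
    exists p, is_dipath e x y p && all (fun z => z \notin S) (x :: p).

Definition m_strong e (m : nat) : Prop :=
  m < #|T| /\ forall S : {set T}, #|S| < m -> strong_without e S.

Definition container_from e (k : nat) a b : Prop :=
  exists P : 'I_k -> seq T,
    [/\ forall i, is_dipath e a b (P i),
        injective P,
        forall i j, i != j -> forall z, z \in interior (P i) -> z \notin interior (P j)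
      & forall z, exists i, z \in a :: P i].

Definition strong_container e (k : nat) u v : Prop :=
  container_from e k u v \/ container_from e k v u.

Definition k_star_strongly_connected e (k : nat) : Prop :=
  forall u v, u != v -> strong_container e k u v.

Definition every_arc_has_2bypass e : Prop :=
  forall u v, e u v -> exists w, e u w && e w v.

End Digraphs.

(* Main.v *)
(* Let [u -> v], and let [X], [Y] be the out-neighbours of [u] and the
   in-neighbours of [v] in [T - {u, v}].  Menger's theorem gives [2k] disjoint
   [X]-[Y] paths in [T - {u, v}]; take such a system covering as many vertices as
   possible, and let [W] be the set of uncovered vertices.  No [w] in [W] can be
   inserted between two consecutive vertices of a path [P], so the vertices of
   [P] dominated by [w] precede those dominating [w].  [W] has a Hamiltonian path
   [w_1 .. w_s] entered from [X] or from some path [P] and left to [Y] or to some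
   path [Q].  If [P] and [Q] differ then [P w_1 .. w_s Q] is an [X]-[Y] path.  If
   they coincide then there are two other paths [P1], [P2] and an index [i] such
   that [P1 w_(i+1) .. w_s P w_1 .. w_i P2] is an [X]-[Y] path.  In all cases
   [T - {u, v}] is spanned by at least [2k - 2 >= k] disjoint [X]-[Y] paths.  Two
   disjoint [X]-[Y] paths can be merged into one like sorted lists, so their
   number can be lowered to [k], and the arc [uv] is the last path. *)
Require Import Defs.
From mathcomp Require Import all_boot zify.
Set Implicit Arguments. Unset Strict Implicit. Unset Printing Implicit Defensive.

Ltac perm_count :=
  apply/permP => ?;
  repeat match goal with H : is_true (perm_eq _ _) |- _ =>
    move/permP: H => /(_ _) H end;
  rewrite -?cats1 /= ?(flatten_cat, count_cat) /= ?(flatten_cat, count_cat) /=.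

(** * Chains and linkages in a digraph *)

Section Linkages.
Variable V : finType.
Implicit Types (e : rel V) (A B : {pred V}) (p q r : seq V) (ps : seq (seq V)).

(** The list holds all vertices of the path, so it is nonempty, and one vertex lying in both [A] and
    [B] is a chain. Repetitions are excluded only by [linkage], whose [uniq (flatten ps)] makes the
    chains both simple and disjoint. *)
Definition chain e A B p : bool :=
  if p is x :: q then [&& x \in A, path e x q & last x q \in B] else false.

Definition linkage e A B ps : bool :=
  all (chain e A B) ps && uniq (flatten ps).

Lemma linkage_perm e A B ps qs :
  perm_eq ps qs -> linkage e A B ps = linkage e A B qs.
Proof.
by move=> pq; rewrite /linkage (perm_all _ pq) (perm_uniq (perm_flatten pq)).
Qed.

(** * Menger's theorem *)

Section Menger.

(* [C] can be taken to be the set of vertices reachable from [A] outside [S]. *)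
Definition separates e (A B S : {set V}) : bool :=
  [exists C : {set V}, [&& A \subset C :|: S, [disjoint C & B :|: S]
    & [forall a in C, forall b, e a b ==> (b \in C :|: S)]]].

Lemma separatesP e (A B S : {set V}) :
  reflect (exists C : {set V},
    [/\ forall a, a \in A -> a \notin S -> a \in C,
        forall c, c \in C -> c \notin B /\ c \notin S
      & forall a b, a \in C -> b \notin S -> e a b -> b \in C])
    (separates e A B S).
Proof.
apply: (iffP existsP) => -[C].
  case/and3P=> /subsetP AC /disjointFr dC /'forall_in_forallP clC; exists C; split.
  - by move=> a /AC; rewrite inE => /orP[//|->].
  - by move=> c /dC; rewrite inE => /norP.
  - by move=> a b aC nbS eab; have := clC a aC b; rewrite eab inE (negPf nbS) orbF.
case=> AC dC clC; exists C; apply/and3P; split.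
- by apply/subsetP => a /AC aC; rewrite inE; case: (boolP (a \in S)) aC => [|_ ->]; rewrite ?orbT.
- by rewrite disjoint_subset; apply/subsetP => c /dC[nB nS]; rewrite !inE negb_or nB.
apply/forall_inP => a aC; apply/forallP => b; apply/implyP => eab; rewrite inE.
by have [|nbS] := boolP (b \in S); rewrite ?orbT // (clC a).
Qed.

Lemma closed_path e (S D : {set V}) z q :
    (forall a b, a \in D -> b \notin S -> e a b -> b \in D) ->
    path e z q -> z \in D -> {in q, forall t, t \notin S} ->
  {subset z :: q <= D}.
Proof.
move=> clD; elim: q z => [|t q IH] z /=; first by move=> _ zD _ u; rewrite inE => /eqP->.
case/andP=> ezt pq zD nS u; rewrite inE => /predU1P[->//|]; apply: IH => //.
- by apply: clD ezt; rewrite ?nS ?mem_head.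
- by move=> v vq; apply: nS; rewrite inE vq orbT.
Qed.

Lemma uniq_flatten_inj ps p q z :
  uniq (flatten ps) -> p \in ps -> q \in ps -> z \in p -> z \in q -> p = q.
Proof.
elim: ps => // r ps IH /=; rewrite cat_uniq => /and3P[_ /hasPn nr /IH{}IH].
rewrite !inE => /predU1P[->|pps] /predU1P[->|qps] // zp zq; last exact: IH.
- by have /nr/negP[] : z \in flatten ps by apply/flattenP; exists q.
- by have /nr/negP[] : z \in flatten ps by apply/flattenP; exists p.
Qed.

Lemma uniq_flatten_mem ps p : uniq (flatten ps) -> p \in ps -> uniq p.
Proof.
by move=> ups /perm_to_rem/perm_flatten/perm_uniq; rewrite ups /= cat_uniq => /esym/and3P[].
Qed.

Lemma uniq_flatten_map (f : seq V -> V) ps :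
  uniq (flatten ps) -> {in ps, forall p, f p \in p} -> uniq (map f ps).
Proof.
elim: ps => //= p ps IH; rewrite cat_uniq => /and3P[_ /hasPn np ups] fp.
rewrite IH // ?andbT => [|q qps]; last by rewrite fp // inE qps orbT.
apply/mapP => -[q qps fpq]; have /np/negP[] : f p \in flatten ps.
  by apply/flattenP; exists q; rewrite // fpq fp // inE qps orbT.
by rewrite fp ?mem_head.
Qed.

Lemma perm_map_lift (f : seq V -> V) ps t :
  perm_eq (map f ps) t -> exists2 qs, perm_eq ps qs & map f qs = t.
Proof.
elim: t ps => [|y t IH] ps perm_t.
  by exists [::] => //; case: ps perm_t => // p ps /perm_size.
have: y \in map f ps by rewrite (perm_mem perm_t) mem_head.
case/mapP=> p pps Ey; have perm_p := perm_to_rem pps.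
have [|qs perm_q Et] := IH (rem p ps).
  by rewrite -(perm_cons y) -(permPr perm_t) Ey -map_cons perm_map // perm_sym.
by exists (p :: qs); rewrite /= ?Ey ?Et // (permPl perm_p) perm_cons.
Qed.

(** Pigeonhole: disjointness makes [f] injective on [ps], so with equal sizes its values exhaust [t]
    and the chains can be listed in the order of [t]. *)
Lemma linkage_map_onto (f : seq V -> V) ps (t : seq V) :
    uniq (flatten ps) -> uniq t -> size ps = size t ->
    {in ps, forall p, (f p \in p) && (f p \in t)} ->
  exists2 qs, perm_eq ps qs & map f qs = t.
Proof.
move=> ups ut size_ps fp; apply: perm_map_lift.
have um : uniq (map f ps) by apply: uniq_flatten_map => // p /fp/andP[].
have sub : {subset map f ps <= t} by move=> _ /mapP[p /fp/andP[_ ?] ->].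
by apply: uniq_perm => //; have [] := uniq_min_size um sub; rewrite ?size_map ?size_ps.
Qed.

(** Each pair shares the vertex where it is glued, and [behead] drops the second copy. *)
Lemma chain_concat e A B C D x0 ps qs :
    all (chain e A C) ps -> all (chain e D B) qs -> map (last x0) ps = map (head x0) qs ->
  all (chain e A B) [seq pq.1 ++ behead pq.2 | pq <- zip ps qs].
Proof.
elim: ps qs => [|p ps IH] [|q qs] //= /andP[cp cps] /andP[cq cqs] [Epq /IH->] //.
rewrite andbT; case: p q cp cq Epq => [|a p] [|b q] // /and3P[aA pp _] /and3P[_ pq lB] /= Eb.
by rewrite aA cat_path pp Eb pq last_cat Eb.
Qed.

Lemma flatten_concat ps qs :
    size ps = size qs ->
  perm_eq (flatten [seq pq.1 ++ behead pq.2 | pq <- zip ps qs])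
    (flatten ps ++ flatten (map behead qs)).
Proof.
elim: ps qs => [|p ps IH] [|q qs] //= [/IH perm_f].
by rewrite -!catA perm_cat2l perm_sym perm_catCA perm_cat2l perm_sym.
Qed.

(* Goering's induction on arcs.  If [S] separates [A] from [B] after deletion of
   [x -> y] and [#|S| < n] then [x |: S] and [y |: S] separate in [e] and have [n]
   elements.  Linkages from [A] to [x |: S] and from [y |: S] to [B] avoiding the
   arc meet only in [S], so they can be concatenated, using the arc once. *)
Lemma menger e (A B : {set V}) n :
    (forall S : {set V}, separates e A B S -> n <= #|S|) ->
  exists2 ps, linkage e A B ps & size ps = n.
Proof.
have [m] := ubnP #|[set ab : V * V | e ab.1 ab.2]|.
elim: m e A B => // m IH e A B le_m min_n.
(* Without arcs, the set of common vertices of [A] and [B] separates, and each of them is a chain by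
   itself. *)
have [/existsP[x /existsP[y exy]]|no_arc] := boolP [exists x, exists y, e x y]; last first.
  have nAB : n <= #|A :&: B|.
    apply: min_n; apply/separatesP; exists (A :\: B); split.
    - by move=> a aA; rewrite !inE aA andbT.
    - by move=> c; rewrite !inE => /andP[/negPf->]; rewrite andbF.
    - by move=> a b _ _ eab; case/negP: no_arc; apply/existsP; exists a; apply/existsP; exists b.
  exists [seq [:: z] | z <- take n (enum (A :&: B))]; last first.
    by rewrite size_map size_takel // -cardE.
  rewrite /linkage flatten_seq1 take_uniq ?enum_uniq // andbT.
  apply/allP => _ /mapP[z /mem_take zAB ->].
  by move: zAB; rewrite mem_enum inE /= => /andP[-> ->].
pose e' a b := e a b && ((a, b) != (x, y)).
have sub_e' : subrel e' e by move=> a b /andP[].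
have le_m' : #|[set ab : V * V | e' ab.1 ab.2]| < m.
  rewrite -ltnS; apply: leq_trans le_m; rewrite ltnS; apply: proper_card; apply/properP; split.
    by apply/subsetP => ab; rewrite !inE => /andP[].
  by exists (x, y); rewrite !inE //= /e' eqxx andbF.
have sub_chain (C D : {pred V}) p : chain e' C D p -> chain e C D p.
  by case: p => // a p /and3P[aC pp lD]; apply/and3P; split; rewrite // (sub_path sub_e').
have [/existsP[S /andP[sepS ltS]]|minS] :=
    boolP [exists S : {set V}, separates e' A B S && (#|S| < n)]; last first.
  have [|ps lps size_ps] := IH e' A B le_m' _.
    move=> S sepS; rewrite leqNgt; apply: contra minS => ltS.
    by apply/existsP; exists S; rewrite sepS.
  exists ps => //; case/andP: lps => cps ups; rewrite /linkage ups andbT.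
  by apply/allP => p /(allP cps)/sub_chain.
have [D [AD dD clD]] := separatesP _ _ _ _ sepS.
(* The only arc of [e] missing in [e'] starts at [x], so [D] without [x] is closed in [e]; below,
   the same works with [y], where that arc ends. *)
have sepx : separates e A B (x |: S).
  apply/separatesP; exists (D :\ x); split.
  - by move=> a aA; rewrite !inE negb_or => /andP[-> /(AD a aA)->].
  - by move=> c; rewrite !inE negb_or => /andP[-> /dD[-> ->]].
  - move=> a b; rewrite !inE negb_or => /andP[nax aD] /andP[-> nbS] eab /=.
    by apply: (clD a); rewrite // /e' eab xpair_eqE (negPf nax).
have sepy : separates e A B (y |: S).
  apply/separatesP; exists (D :\ y); split.
  - by move=> a aA; rewrite !inE negb_or => /andP[-> /(AD a aA)->].
  - by move=> c; rewrite !inE negb_or => /andP[-> /dD[-> ->]].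
  - move=> a b; rewrite !inE negb_or => /andP[nay aD] /andP[nby nbS] eab /=.
    by rewrite nby; apply: (clD a); rewrite // /e' eab xpair_eqE (negPf nby) andbF.
(* As [S] has fewer than [n] elements, both [x] and [y] must be new to it, and [S] has exactly
   [n - 1] elements. *)
have := min_n _ sepx; have := min_n _ sepy; rewrite !cardsU1 => ny nx.
have xS : x \notin S by apply: contraTN nx => ->; rewrite -ltnNge.
have yS : y \notin S by apply: contraTN ny => ->; rewrite -ltnNge.
have sizeS : n = #|S|.+1 by apply/eqP; rewrite eqn_leq ltS andbT; move: nx; rewrite xS.
have [|ps0 lps0 size_ps0] := IH e' A (x |: S) le_m' _.
  move=> Q /separatesP[C [AC dC clC]]; apply: min_n; apply/separatesP.
  have CS c : c \in C -> (c != x) /\ (c \notin S).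
    by move=> /dC[]; rewrite !inE => /norP.
  (* [C] avoids [x], so arcs leaving it are arcs of [e']; [C] also avoids [S], which keeps their
     ends in [D]. *)
  exists (C :&: D); split.
  - by move=> a aA nQ; have aC := AC a aA nQ; rewrite inE aC AD //; case: (CS a aC).
  - by move=> c; rewrite inE => /andP[/dC[_ ->] /dD[->]].
  - move=> a b; rewrite !inE => /andP[aC aD] nbQ eab.
    have e'ab : e' a b by rewrite /e' eab xpair_eqE; have [/negPf->] := CS a aC.
    have bC := clC a b aC nbQ e'ab; rewrite bC /=.
    by apply: (clD a) => //; case: (CS b bC).
have [|qs0 lqs0 size_qs0] := IH e' (y |: S) B le_m' _.
  move=> Q /separatesP[C [AC dC clC]]; apply: min_n; apply/separatesP.
  have SC c : c \in y |: S -> c \notin Q -> c \in C by exact: AC.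
  (* An arc ending in [y |: S] outside [Q] ends in [C]; any other arc is an arc of [e'] that ends
     outside [S], so [C] and [D] are each closed under it. *)
  exists ((C :|: D) :\: Q); split.
  - move=> a aA nQ; rewrite !inE nQ /=; have [aS|/(AD a aA)->] := boolP (a \in S).
      by rewrite SC // inE aS orbT.
    by rewrite orbT.
  - by move=> c; rewrite !inE => /andP[nQ /orP[/dC[-> _]|/dD[-> _]]].
  - move=> a b; rewrite !inE => /andP[naQ aCD] nbQ eab; rewrite nbQ /=.
    have [byS|] := boolP (b \in y |: S); first by rewrite SC.
    rewrite !inE => /norP[nby nbS].
    have e'ab : e' a b by rewrite /e' eab xpair_eqE (negPf nby) andbF.
    by case/orP: aCD => [/clC->//|/clD->]; rewrite // orbT.
case/andP: lps0 => /allP cps0 ups0; case/andP: lqs0 => /allP cqs0 uqs0.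
(* Both linkages are listed along [enum S], with the chain ending in [x] and the chain starting in
   [y] in front. *)
have [|||ps perm_ps lastps] := @linkage_map_onto (last x) ps0 (x :: enum S) ups0.
- by rewrite /= mem_enum xS enum_uniq.
- by rewrite size_ps0 /= -cardE.
- move=> p /cps0; case: p => // a p /and3P[_ _ lS].
  apply/andP; split; first exact: (mem_last a p).
  by move: lS; rewrite /= !inE mem_enum.
have [|||qs perm_qs headqs] := @linkage_map_onto (head y) qs0 (y :: enum S) uqs0.
- by rewrite /= mem_enum yS enum_uniq.
- by rewrite size_qs0 /= -cardE.
- by move=> q /cqs0; case: q => // a q /and3P[+ _ _]; rewrite /= !inE mem_enum eqxx.
have {ups0} ups : uniq (flatten ps) by rewrite -(perm_uniq (perm_flatten perm_ps)).
have {uqs0} uqs : uniq (flatten qs) by rewrite -(perm_uniq (perm_flatten perm_qs)).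
have {cps0} cps p : p \in ps -> chain e' (mem A) (mem (x |: S)) p.
  by rewrite -(perm_mem perm_ps) => /cps0.
have {cqs0} cqs q : q \in qs -> chain e' (mem (y |: S)) (mem B) q.
  by rewrite -(perm_mem perm_qs) => /cqs0.
(* Every vertex of [x |: S] is already the last vertex of some chain, so by disjointness a chain
   meets this set only at its end. *)
have lastS p z : p \in ps -> z \in p -> z \in x |: S -> z = last x p.
  move=> pps zp; rewrite !inE -mem_enum -in_cons -lastps => /mapP[p' pps' Ez].
  rewrite Ez; congr (last x _); apply: (uniq_flatten_inj ups pps' pps _ zp).
  by have := cps _ pps'; rewrite Ez; case: (p') => // a r _; apply: (mem_last a r).
have headS q z : q \in qs -> z \in q -> z \in y |: S -> z = head y q.
  move=> qqs zq; rewrite !inE -mem_enum -in_cons -headqs => /mapP[q' qqs' Ez].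
  rewrite Ez; congr (head y _); apply: (uniq_flatten_inj uqs qqs' qqs _ zq).
  by have := cqs _ qqs'; rewrite Ez; case: (q') => // a r _; apply: mem_head.
(* The part of [p] up to [z] starts in [A] and avoids [S], hence stays in the closed set [D]. *)
have psD p z : p \in ps -> z \in p -> z \notin S -> z \in D.
  move=> pps zp nzS; have up := uniq_flatten_mem ups pps.
  have := cps p pps; have := lastS p _ pps.
  case: p {pps} zp up => // a p zp up lastp /and3P[aA pp _].
  case/splitPl: zp => p1 p2 lz in up lastp pp *.
  have p1S : {in a :: p1, forall t, t \notin S}.
    move=> t tp1; apply/negP => tS.
    have Et : t = last z p2.
      have := lastp t; rewrite /= last_cat lz; apply.
        by rewrite -cat_cons mem_cat tp1.
      by rewrite inE tS orbT.
    case: p2 => [|b p2] in up lastp pp Et *; first by rewrite -[z]Et tS in nzS.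
    move: up; rewrite -cat_cons cat_uniq => /and3P[_ /hasPn/(_ t) + _].
    by rewrite Et (mem_last b p2) -[last _ _]Et tp1 => /(_ isT).
  move: pp; rewrite cat_path => /andP[pp1 _].
  apply: (closed_path clD pp1); last by rewrite -lz mem_last.
    by apply: AD => //; apply: p1S; rewrite mem_head.
  by move=> t tp1; apply: p1S; rewrite inE tp1 orbT.
(* After its head [q] avoids [S], so from a vertex of [D] it would stay in [D] up to its end in [B],
   which [D] avoids. *)
have qsD q z : q \in qs -> z \in q -> z \notin S -> z \notin D.
  move=> qqs zq nzS; have uq := uniq_flatten_mem uqs qqs.
  have := cqs q qqs; have := headS q _ qqs.
  case: q {qqs} zq uq => // a q zq uq headq /and3P[_ pq lB].
  case/splitPl: zq => q1 q2 lz in uq headq pq lB *.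
  apply/negP => zD; move: pq lB; rewrite cat_path last_cat lz => /andP[_ pq2] lB.
  have q2S : {in q2, forall t, t \notin S}.
    move=> t tq2; apply/negP => tS; have Et : t = a.
      by apply: headq; rewrite ?inE ?mem_cat ?tq2 ?tS ?orbT.
    by move: uq; rewrite /= mem_cat -Et tq2 orbT.
  have lD : last z q2 \in D by apply: (closed_path clD pq2 zD q2S); apply: mem_last.
  by have [/negP[]] := dD _ lD.
case: ps lastps ups cps lastS psD perm_ps => [|px pS] //= [lastx lastpS] ups cps lastS psD perm_ps.
case: qs headqs uqs cqs headS qsD perm_qs => [|qy qS] //= [heady headqS] uqs cqs headS qsD perm_qs.
have size_pq : size pS = size qS.
  by rewrite -(size_map (last x)) -(size_map (head y)) lastpS headqS.
have size_pS : size pS = #|S| by rewrite -(size_map (last x)) lastpS -cardE.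
(* The first chain uses the arc from [x] to [y]; the others are glued at the vertices of [S]. *)
exists ((px ++ qy) :: [seq pq.1 ++ behead pq.2 | pq <- zip pS qS]); last first.
  by rewrite /= size_map size_zip -size_pq minnn size_pS.
apply/andP; split.
  rewrite /=; apply/andP; split.
    have := cps px (mem_head _ _); have := cqs qy (mem_head _ _).
    case: px qy lastx heady {cps cqs lastS headS psD qsD perm_ps perm_qs ups uqs}
      => [|a p] [|b q] //= lastx heady /and3P[_ pq lB] /and3P[aA pp _].
    have exb : e (last a p) b by rewrite lastx heady.
    by rewrite aA cat_path (sub_path sub_e' pp) /= exb (sub_path sub_e' pq) last_cat.
  apply: (chain_concat (x0 := x) (C := mem (x |: S)) (D := mem (y |: S))).
  - by apply/allP => p pps; apply: sub_chain; apply: cps; rewrite inE pps orbT.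
  - by apply/allP => q qqs; apply: sub_chain; apply: cqs; rewrite inE qqs orbT.
  rewrite lastpS -headqS; apply/eq_in_map => q qqs.
  by have := cqs q; rewrite inE qqs orbT => /(_ isT); case: (q).
have /perm_uniq-> : perm_eq
    (flatten ((px ++ qy) :: [seq pq.1 ++ behead pq.2 | pq <- zip pS qS]))
    (flatten (px :: pS) ++ qy ++ flatten (map behead qS)).
  rewrite /= -!catA perm_cat2l perm_sym perm_catCA perm_cat2l perm_sym.
  exact: flatten_concat.
rewrite cat_uniq ups /=; apply/andP; split.
  apply/hasPn => z; rewrite mem_cat => zq; apply/negP => zf.
  have /flattenP[p pps zp] : z \in flatten (px :: pS) by exact: zf.
  have [q qqs zq'] : exists2 q, q \in qy :: qS & (z \in q) && (z \notin S).
    case/orP: zq => [zq|/flattenP[_ /mapP[q qqs ->] zq]].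
      exists qy; rewrite ?mem_head // zq; apply/negP => zS.
      have Ez : z = y by rewrite (headS qy z (mem_head _ _) zq) ?heady // inE zS orbT.
      by rewrite -Ez zS in yS.
    have qqs' : q \in qy :: qS by rewrite inE qqs orbT.
    have zq' := mem_behead zq; exists q; rewrite // zq' /=; apply/negP => zS.
    have Ez : z = head y q by apply: headS; rewrite // inE zS orbT.
    have := uniq_flatten_mem (ps := qy :: qS) uqs qqs'.
    by case: (q) zq Ez => // a r /= zr Ea; rewrite -Ea zr.
  by case/andP: zq' => zq' nzS; case/negP: (qsD q z qqs zq' nzS); apply: (psD p).
apply: subseq_uniq uqs; rewrite /= cat_subseq //.
by elim: (qS) => //= q r IHr; rewrite cat_subseq //; case: (q) => //= *; apply: subseq_cons.
Qed.
End Menger.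

(** * Linkages in tournaments *)

Section Tournament.
Variable e : rel V.
Hypothesis tour : is_tournament e.

Lemma tourN a b : a != b -> e a b = ~~ e b a.
Proof. by case: tour => _ /[apply]; case: (e a b) (e b a) => [] []. Qed.

Lemma tour_or a b : a != b -> ~~ e a b -> e b a.
Proof. by move=> /tourN->; rewrite negbK. Qed.

Lemma tour_asym a b : e a b -> e b a -> False.
Proof.
have [->|/tourN->] := eqVneq a b; last by case: (e b a).
by case: tour => /(_ b)/negP.
Qed.

(* The merge of two chains starts with the winner of the arc between their first
   vertices [x -> y]: the rest then merges as two chains from out-neighbours of [x]. *)
Lemma chain_merge A B p q :
    chain e A B p -> chain e A B q -> uniq (p ++ q) ->
  exists2 r, chain e A B r & perm_eq r (p ++ q).
Proof.
have [n] := ubnP (size p + size q); elim: n A p q => // n IH A p q le_n.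
case: p q le_n => [|x p] [|y q] //= le_n cp cq.
wlog: x y p q le_n cp cq / e x y => [WL|exy].
  move=> uq; have neq_xy: x != y.
    by apply: contraTneq uq => ->; rewrite mem_cat inE eqxx orbT.
  have [exy|] := boolP (e x y); first exact: (WL x y p q).
  rewrite -tourN 1?eq_sym // => eyx.
  have /(WL y x q p)[] //: uniq (y :: q ++ x :: p).
  - by rewrite -cat_cons uniq_catC.
  - by move: le_n; rewrite /=; lia.
  by move=> r cr pr; exists r => //; rewrite (permPl pr) -cat_cons perm_catC.
move=> /andP[_ uq]; case/and3P: cp => xA pp lp.
case: p => [|z p] in le_n pp lp uq *.
  by exists (x :: y :: q) => //=; case/and3P: cq => _ pq lq; rewrite xA exy pq.
have [|||r] := IH (e x) (z :: p) (y :: q) _ _ _ uq.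
- by move: le_n => /=; lia.
- by case/andP: pp => exz pp; apply/and3P.
- by case/and3P: cq => _ pq lq; apply/and3P.
move=> cr pr; exists (x :: r); last by rewrite perm_cons.
by case: r cr pr => //= t r /and3P[ext -> ->] _; rewrite xA (ext : e x t).
Qed.

(** * Insertion into chains and Hamiltonian chains *)

(** [w] goes just before the first vertex it dominates: the preceding vertex dominates [w]. *)
Lemma path_insert x q w :
    path e x q -> e x w -> e w (last x q) -> w \notin x :: q ->
  exists r, [/\ path e x r, last x r = last x q & perm_eq r (w :: q)].
Proof.
elim: q x => [|y q IH] x /=; first by move=> _ exw /(tour_asym exw).
case/andP=> exy pq exw ewl; rewrite inE negb_or => /andP[_ wq].
have [ewy|] := boolP (e w y); first by exists [:: w, y & q]; rewrite /= exw ewy.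
rewrite -tourN => [eyw|]; last by case/norP: wq => + _; rewrite eq_sym.
have [r [pr lr perm_r]] := IH y pq eyw ewl wq.
exists (y :: r); rewrite /= exy pr lr; split=> //.
by perm_count; rewrite perm_r /=; clear; lia.
Qed.

(** If the end of [p] does not dominate [w], then [w] dominates it, and [path_insert] applies to the
    part of [p] from [z] on. *)
Lemma insert_or_last A B p w z :
    chain e A B p -> w \notin p -> z \in p -> e z w ->
  e (last w p) w \/ exists2 r, chain e A B r & perm_eq r (w :: p).
Proof.
case: p => // x q /and3P[xA pq lB] wp zp ezw.
have [|nlw] := boolP (e (last w (x :: q)) w); [by left | right].
case/splitPl: zp => q1 q2 lz in pq lB wp nlw *.
move: pq lB nlw; rewrite /= cat_path last_cat lz => /andP[pq1 pq2] lB.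
have wz: w \notin z :: q2.
  apply: contra wp; rewrite -cat_cons mem_cat !inE => /orP[/eqP->|->]; last by rewrite orbT.
  by rewrite -lz -in_cons mem_last.
rewrite -tourN => [ewl|]; last by apply: contraNneq wz => ->; rewrite mem_last.
have [r [pr lr perm_r]] := path_insert pq2 ezw ewl wz.
exists (x :: q1 ++ r); first by rewrite /= xA cat_path pq1 lz pr last_cat lz lr.
by perm_count; rewrite perm_r /=; clear; lia.
Qed.

Lemma insert_or_head A B p w z :
    chain e A B p -> w \notin p -> z \in p -> e w z ->
  e w (head w p) \/ exists2 r, chain e A B r & perm_eq r (w :: p).
Proof.
case: p => // x q /and3P[xA pq lB] wp zp ewz /=.
have [|nwx] := boolP (e w x); [by left | right].
case/splitPl: zp => q1 q2 lz in pq lB wp *.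
move: pq lB; rewrite /= cat_path last_cat lz => /andP[pq1 pq2] lB.
have wq1: w \notin x :: q1.
  by apply: contra wp; rewrite -cat_cons mem_cat => ->.
have exw: e x w by rewrite tourN //; apply: contraNneq wp => ->; rewrite mem_head.
have [|r [pr lr perm_r]] := path_insert pq1 exw _ wq1; first by rewrite lz.
exists (x :: r ++ q2); first by rewrite /= xA cat_path pr lr lz pq2 last_cat lr lz.
by perm_count; rewrite perm_r /=; clear; lia.
Qed.

(* If no vertex [z] of [W] can be added to a longest chain, then [z] either is
   in [I] and dominated by the whole chain, or is in [O] and dominates it. *)
Lemma hamiltonian_chain (W : {set V}) (I O : {pred V}) :
    W != set0 ->
    (forall w, w \in W -> (w \in I) || (w \in O)) ->
    (forall Z : {set V}, Z \subset W -> Z != set0 -> (forall z, z \in Z -> z \notin I) ->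
       exists a b, [/\ a \in W :\: Z, b \in Z & e a b]) ->
    (forall Z : {set V}, Z \subset W -> Z != set0 -> (forall z, z \in Z -> z \notin O) ->
       exists a b, [/\ a \in Z, b \in W :\: Z & e a b]) ->
  exists p, [/\ chain e I O p, uniq p & p =i W].
Proof.
move=> W0 IO cutI cutO.
(* A starting chain: one vertex in both [I] and [O], or, if these are complementary in [W], an arc
   from [I] to [O] given by [cutI]. *)
have [p0 [cp0 up0 sp0]] : exists p, [/\ chain e I O p, uniq p & {subset p <= W}].
  have [/existsP[z /and3P[zW zI zO]]|/existsPn nIO] :=
      boolP [exists z, [&& z \in W, z \in I & z \in O]].
    by exists [:: z]; split=> // [|t]; rewrite /= ?zI // inE => /eqP->.
  have OI w : w \in W -> (w \in O) = (w \notin I).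
    move=> wW; have := IO w wW; have := nIO w; rewrite wW.
    by case: (w \in I) (w \in O) => [] [].
  pose Z := [set w in W | w \in O].
  have [||z|a [b [aWZ bZ eab]]] := cutI Z.
  - by apply/subsetP => w; rewrite inE => /andP[].
  - apply/eqP => Z0.
    have WO w : w \in W -> w \notin O.
      by move=> wW; apply/negP => wO; have := in_set0 w; rewrite -Z0 inE wW wO.
    by have [a [b [_]]] := cutO W (subxx _) W0 WO; rewrite setDv inE.
  - by rewrite inE => /andP[zW]; rewrite OI.
  move: aWZ bZ; rewrite !inE => /andP[] + aW /andP[bW bO]; rewrite aW /= OI // negbK => aI.
  exists [:: a; b]; split; first by rewrite /= aI eab bO.
    by rewrite /= inE andbT; apply: contraTneq aI => ->; rewrite -OI.
  by move=> t; rewrite !inE => /pred2P[]->.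
have [n] := ubnP (#|W| - size p0); elim: n p0 cp0 up0 sp0 => // n IH p cp up sp le_n.
pose Z := W :\: [set t in p].
have ZE t : (t \in Z) = (t \notin p) && (t \in W) by rewrite !inE.
set goal := exists _, _.
have extend r s : chain e I O r -> perm_eq r (s ++ p) -> s != [::] ->
    uniq s -> {subset s <= Z} -> goal.
  move=> cr pr s0 us sZ; apply: (IH r) => //.
  - rewrite (perm_uniq pr) cat_uniq us up andbT /=; apply/hasPn => t tp.
    by apply/negP => /sZ; rewrite ZE tp.
  - by move=> t; rewrite (perm_mem pr) mem_cat => /orP[/sZ|/sp //]; rewrite ZE => /andP[].
  have lt_pW: size p < #|W|.
    rewrite -(card_uniqP up); apply: proper_card; apply/properP; split.
      by apply/subsetP.
    case: s s0 sZ {pr us} => // t s _ /(_ t (mem_head _ _)).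
    by rewrite ZE => /andP[tp tW]; exists t.
  have := perm_size pr; rewrite size_cat; case: s s0 {pr us sZ} => //= t s _; lia.
have extend1 r z : z \in Z -> chain e I O r -> perm_eq r (z :: p) -> goal.
  by move=> zZ cr pr; apply: (extend r [:: z]) => // t; rewrite inE => /eqP->.
have neqZ z t : z \in Z -> t \in p -> z != t.
  by rewrite ZE => /andP[zp _]; apply: contraTneq => <-.
(* A missed vertex of [I] can be prepended, appended or inserted, unless it is outside [O] and
   dominated by all of [p]. *)
have [//|dI] : goal \/ forall z, z \in Z -> z \in I -> (z \notin O) && all (e^~ z) p.
  have [/forall_inP dI|] := boolP [forall z in Z, (z \in I) ==> (z \notin O) && all (e^~ z) p].
    by right=> z /dI/implyP.
  rewrite negb_forall_in => /exists_inP[z zZ]; rewrite negb_imply => /andP[zI nz]; left.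
  have zp: z \notin p by move: zZ; rewrite ZE => /andP[].
  case: p => // x q in cp up sp le_n @Z ZE extend extend1 neqZ zZ nz zp *.
  case/and3P: (cp) => xI pq lO.
  have [ezx|/tour_or-/(_ (neqZ _ _ zZ (mem_head _ _))) exz] := boolP (e z x).
    by apply: (extend1 (z :: x :: q) z) => //=; rewrite zI ezx pq.
  have [/= elz|[r cr]] := insert_or_last cp zp (mem_head x q) exz; last exact: extend1.
  move: nz; rewrite negb_and negbK => /orP[zO|/allPn[t tp netz]].
    apply: (extend1 (rcons (x :: q) z) z) => //; last by rewrite perm_rcons.
    by rewrite /= xI rcons_path pq last_rcons elz.
  have ezt: e z t by rewrite tourN ?neqZ.
  have [/(tour_asym exz)//|[r cr]] := insert_or_head cp zp tp ezt; exact: extend1.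
have [//|dO] : goal \/ forall z, z \in Z -> z \in O -> (z \notin I) && all (e z) p.
  have [/forall_inP dO|] := boolP [forall z in Z, (z \in O) ==> (z \notin I) && all (e z) p].
    by right=> z /dO/implyP.
  rewrite negb_forall_in => /exists_inP[z zZ]; rewrite negb_imply => /andP[zO nz]; left.
  have zp: z \notin p by move: zZ; rewrite ZE => /andP[].
  have zI: z \notin I by apply: contraL zO => /(dI z zZ)/andP[].
  case: p => // x q in cp up sp le_n @Z ZE extend extend1 neqZ zZ nz zp dI *.
  case/and3P: (cp) => xI pq lO.
  have [elz|] := boolP (e (last x q) z).
    apply: (extend1 (rcons (x :: q) z) z) => //; last by rewrite perm_rcons.
    by rewrite /= xI rcons_path pq last_rcons elz.
  rewrite -tourN ?neqZ ?mem_last // => ezl.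
  have [ezx|[r cr]] := insert_or_head cp zp (mem_last x q) ezl; last exact: extend1.
  move: nz; rewrite zI => /allPn[t tp].
  rewrite -tourN => [etz|]; last by rewrite eq_sym neqZ.
  have [/(tour_asym ezl)//|[r cr]] := insert_or_last cp zp tp etz; exact: extend1.
have [Z0|Z0] := eqVneq Z set0.
  exists p; split=> // t; apply/idP/idP => [/sp //|tW]; apply/negPn/negP => tp.
  by have := ZE t; rewrite Z0 inE tp tW.
pose Z1 := [set z in Z | z \in I].
(* If [Z] avoids [I], an arc enters [Z] from [p] by [cutI], although its end lies in [O] and
   dominates [p]. *)
have [Z10|Z10] := eqVneq Z1 set0.
  have ZI z : z \in Z -> z \notin I.
    by move=> zZ; apply/negP => zI; have := in_set0 z; rewrite -Z10 inE zZ zI.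
  have [|a [b [aWZ bZ eab]]] := cutI Z _ Z0 ZI; first exact: subsetDl.
  have bW: b \in W by move: bZ; rewrite ZE => /andP[].
  have bO: b \in O by have := IO b bW; rewrite (negPf (ZI b bZ)).
  have ap: a \in p by move: aWZ; rewrite !inE => /andP[+ aW]; rewrite aW andbT negbK.
  by have /andP[_ /allP/(_ a ap)/(tour_asym eab)] := dO b bZ bO.
(* The arc leaving [Z1] cannot end on [p], which dominates [a]; so [b] is a missed vertex dominating
   [p], and [a], [b] go in front of [p]. *)
have [|z|a [b [aZ1 bWZ1 eab]]] := cutO Z1 _ Z10.
- by apply/subsetP => z; rewrite inE ZE => /andP[/andP[]].
- by rewrite inE => /andP[zZ /(dI z zZ)/andP[]].
move: aZ1; rewrite inE => /andP[aZ aI]; move: bWZ1; rewrite in_setD => /andP[bZ1 bW].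
have /andP[_ /allP pa] := dI a aZ aI.
have [bp|bp] := boolP (b \in p); first by case: (tour_asym eab (pa b bp)).
have bZ: b \in Z by rewrite ZE bp.
have bI: b \notin I by move: bZ1; rewrite inE bZ.
have bO: b \in O by have := IO b bW; rewrite (negPf bI).
have /andP[_ /allP bpp] := dO b bZ bO.
apply: (extend (a :: b :: p) [:: a; b]) => //=.
- move: cp bpp; clear - aI eab; case: p => // x q /and3P[_ pq lO] bpp.
  by rewrite /= aI eab bpp ?mem_head // pq.
- by rewrite inE andbT; apply: contraTneq aI => ->.
by move=> t; rewrite !inE => /pred2P[]->; rewrite -ZE.
Qed.

(** * Rearranging linkages until they span *)

(** The common form of all later changes: the chains [qs] and new vertices [s] are respliced into
    one chain [r]. Empty [s] is a merge, empty [qs] a new chain. *)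
Lemma linkage_replace A B ps qs rest r s :
    linkage e A B ps -> perm_eq ps (qs ++ rest) -> chain e A B r ->
    perm_eq r (s ++ flatten qs) -> uniq (s ++ flatten ps) ->
  linkage e A B (r :: rest) /\ perm_eq (flatten (r :: rest)) (s ++ flatten ps).
Proof.
move=> lps perm_ps cr perm_r us.
have perm_f: perm_eq (flatten (r :: rest)) (s ++ flatten ps).
  have := perm_flatten perm_ps => perm_fps.
  by perm_count; rewrite perm_fps perm_r !(flatten_cat, count_cat) /=; lia.
split=> //; rewrite /linkage (perm_uniq perm_f) us andbT /= cr /=.
by move: lps; rewrite (linkage_perm _ _ _ perm_ps) => /andP[]; rewrite all_cat => /andP[].
Qed.

(** Local maximality suffices: no chain can be rearranged so as to absorb one uncovered vertex. Each
    such absorption lowers the number of uncovered vertices. *)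
Lemma maximal_linkage A B ps :
    linkage e A B ps ->
  exists qs, [/\ linkage e A B qs, size qs = size ps &
    forall p w r, p \in qs -> w \notin flatten qs -> chain e A B r -> ~~ perm_eq r (w :: p)].
Proof.
have [n] := ubnP (#|V| - size (flatten ps)); elim: n ps => // n IH ps le_n lps.
pose addable p w := has (chain e A B) (permutations (w :: p)).
have [/hasP[p pps /existsP[w /andP[wps /hasP[r]]]]|noadd] :=
    boolP (has (fun p => [exists w, (w \notin flatten ps) && addable p w]) ps); last first.
  exists ps; split=> // p w r pps wps cr; apply: contra noadd => perm_r.
  apply/hasP; exists p => //; apply/existsP; exists w; rewrite wps; apply/hasP.
  by exists r; rewrite ?mem_permutations // perm_sym.
rewrite mem_permutations => perm_r cr.
have perm_ps: perm_eq ps ([:: p] ++ rem p ps) by exact: perm_to_rem.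
case/andP: (lps) => _ ups; have uwps: uniq (w :: flatten ps) by rewrite /= wps ups.
have [|lqs perm_f] := linkage_replace (s := [:: w]) lps perm_ps cr _ uwps.
  by rewrite /= cats0.
have [|qs [lqs' size_qs max_qs]] := IH _ _ lqs.
  have := max_card (mem (w :: flatten ps)); rewrite (card_uniqP uwps) /=.
  by rewrite (perm_size perm_f) subnS => ltV; rewrite prednK ?subn_gt0.
by exists qs; split=> //; rewrite size_qs (perm_size perm_ps).
Qed.

Lemma linkage_reduce A B ps m :
    linkage e A B ps -> 0 < m <= size ps ->
  exists qs, [/\ linkage e A B qs, size qs = m & perm_eq (flatten qs) (flatten ps)].
Proof.
have [n] := ubnP (size ps); elim: n ps => // n IH ps le_n lps /andP[m0].
rewrite leq_eqVlt => /predU1P[->|lt_m]; first by exists ps.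
case: ps => [|p [|q ps]] // in le_n lps lt_m *; first by case: m m0 lt_m {IH} => // [[]].
have /andP[/= /and3P[cp cq _] ups] := lps.
have [|r cr perm_r] := chain_merge cp cq.
  by move: ups; rewrite /= catA cat_uniq => /and3P[].
have [|lqs perm_f] := linkage_replace (s := [::]) (qs := [:: p; q]) lps (perm_refl _) cr _ ups.
  by rewrite /= cats0.
have [||qs [lqs' size_qs perm_q]] := IH _ _ lqs.
- by move: le_n => /=; lia.
- by move: lt_m => /=; lia.
by exists qs; split=> //; apply: perm_trans perm_q perm_f.
Qed.

(** At most three chains are traded for one, hence a loss of at most two. The two cut conditions
    amount to every vertex being reachable from [A] and reaching [B]. *)
Lemma spanning_linkage A B ps :
    (forall Z : {set V}, Z != set0 -> (forall z, z \in Z -> z \notin A) ->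
       exists a b, [/\ a \notin Z, b \in Z & e a b]) ->
    (forall Z : {set V}, Z != set0 -> (forall z, z \in Z -> z \notin B) ->
       exists a b, [/\ a \in Z, b \notin Z & e a b]) ->
    linkage e A B ps -> 2 < size ps ->
  exists qs, [/\ linkage e A B qs, size ps <= (size qs).+2, 0 < size qs
    & forall z, z \in flatten qs].
Proof.
move=> cutA cutB /maximal_linkage[qs [lqs <- max_qs]] size_qs.
move: qs size_qs lqs max_qs => {}ps size_ps0 lps max_ps.
set goal := exists _, _.
have /andP[/allP cps ups] := lps.
pose W := [set w | w \notin flatten ps].
have WE w : (w \in W) = (w \notin flatten ps) by rewrite inE.
have [W0|W0] := eqVneq W set0.
  exists ps; split=> // [||t]; [by lia | by lia |].
  by apply/negPn; rewrite -WE W0 inE.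
pose I := [pred w | (w \in A) || has (e^~ w) (flatten ps)].
pose O := [pred w | (w \in B) || has (e w) (flatten ps)].
have p0ps : nth [::] ps 0 \in ps by rewrite mem_nth // (ltn_trans _ size_ps0).
have memf p z : p \in ps -> z \in p -> z \in flatten ps.
  by move=> pps zp; apply/flattenP; exists p.
(* An arc entering a part of [W] that avoids [I] cannot start at a covered vertex, so it starts in
   [W]; dually for [O]. *)
have [|||ws [cws uws wsW]] := @hamiltonian_chain W I O W0.
- move=> w; rewrite WE => wps; rewrite !inE.
  case: (nth [::] ps 0) p0ps (cps _ p0ps) => // x q p0ps _.
  have xf : x \in flatten ps by apply: (memf _ _ p0ps); rewrite mem_head.
  have [ewx|/tour_or exw] := boolP (e w x).
    by apply/orP; right; apply/orP; right; apply/hasP; exists x.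
  apply/orP; left; apply/orP; right; apply/hasP; exists x => //.
  by apply: exw; apply: contraNneq wps => ->.
- move=> Z ZW Z0 ZI; have [z zZ|a [b [aZ bZ eab]]] := cutA Z Z0.
    by have := ZI z zZ; rewrite inE => /norP[].
  exists a, b; split=> //; rewrite in_setD aZ WE.
  by have := ZI b bZ; rewrite inE => /norP[_]; apply: contra => af; apply/hasP; exists a.
- move=> Z ZW Z0 ZO; have [z zZ|a [b [aZ bZ eab]]] := cutB Z Z0.
    by have := ZO z zZ; rewrite inE => /norP[].
  exists a, b; split=> //; rewrite in_setD bZ WE.
  by have := ZO a aZ; rewrite inE => /norP[_]; apply: contra => bf; apply/hasP; exists b.
have uwps : uniq (ws ++ flatten ps).
  rewrite cat_uniq uws ups andbT; apply/hasPn => t tf; rewrite wsW WE; exact: contraL tf.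
have finish qs rest r : perm_eq ps (qs ++ rest) -> size qs <= 3 -> chain e A B r ->
    perm_eq r (ws ++ flatten qs) -> goal.
  move=> perm_ps size_qs cr perm_r.
  have [lqs perm_f] := linkage_replace lps perm_ps cr perm_r uwps.
  exists (r :: rest); split=> // [|t].
    by rewrite (perm_size perm_ps) size_cat /= -addn3 addnC leq_add2l.
  by rewrite (perm_mem perm_f) mem_cat wsW WE orNb.
have no_add p w : p \in ps -> w \in ws ->
    ~ (exists2 r, chain e A B r & perm_eq r (w :: p)).
  rewrite wsW WE => pps wps [r cr perm_r].
  by have := max_ps p w r pps wps cr; rewrite perm_r.
have notin p w : p \in ps -> w \in ws -> w \notin p.
  by rewrite wsW WE => pps; apply: contra => /(memf _ _ pps).
(* Insertion being impossible, one vertex of [p] dominating [w] forces the last one to do so. The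
   default of [last] is harmless, as chains are nonempty. *)
have lastW p w z : p \in ps -> w \in ws -> z \in p -> e z w -> e (last w p) w.
  move=> pps wws zp ezw.
  by have [//|/no_add-/(_ pps wws)] := insert_or_last (cps p pps) (notin p w pps wws) zp ezw.
have headW p w z : p \in ps -> w \in ws -> z \in p -> e w z -> e w (head w p).
  move=> pps wws zp ezw.
  by have [//|/no_add-/(_ pps wws)] := insert_or_head (cps p pps) (notin p w pps wws) zp ezw.
have [w1 [wr Ews]] : exists w1 wr, ws = w1 :: wr by case: (ws) cws => // w1 wr; exists w1, wr.
move: (cws); rewrite Ews => /and3P[w1I pws wlO].
have w1ws : w1 \in ws by rewrite Ews mem_head.
have wlws : last w1 wr \in ws by rewrite Ews mem_last.
have {w1I} [w1A|[p pps lp]] : w1 \in A \/ exists2 p, p \in ps & e (last w1 p) w1.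
  case/orP: w1I => [|/hasP[z /flattenP[p pps zp] ezw]]; [by left | right].
  by exists p => //; apply: lastW ezw.
  have {wlO} [wlB|[q qps hq]] : last w1 wr \in B \/
      exists2 q, q \in ps & e (last w1 wr) (head (last w1 wr) q).
    case/orP: wlO => [|/hasP[z /flattenP[q qps zq] ewz]]; [by left | right].
    by exists q => //; apply: headW ewz.
  - apply: (finish [::] ps ws); rewrite ?cats0 ?Ews //=.
    by rewrite w1A pws.
  have perm_ps := perm_to_rem qps; have cq := cps q qps.
  case: q qps hq perm_ps cq => // y q qps hq perm_ps /and3P[yA pq lB].
  apply: (finish [:: y :: q] _ (ws ++ y :: q) perm_ps); rewrite /= ?cats0 // Ews /=.
  by rewrite w1A cat_path pws /= hq pq last_cat /= lB.
have {wlO} [wlB|[q qps hq]] : last w1 wr \in B \/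
    exists2 q, q \in ps & e (last w1 wr) (head (last w1 wr) q).
  case/orP: wlO => [|/hasP[z /flattenP[q qps zq] ewz]]; [by left | right].
  by exists q => //; apply: headW ewz.
  have perm_ps := perm_to_rem pps; have cp := cps p pps.
  case: p pps lp perm_ps cp => // x p pps lp perm_ps /and3P[xA pp lB].
  apply: (finish [:: x :: p] _ (x :: p ++ ws) perm_ps) => //.
    by rewrite Ews /= xA cat_path pp /= lp pws last_cat.
  by rewrite /= cats0 -cat_cons perm_catC.
have two p1 p2 rest : perm_eq ps ([:: p1; p2] ++ rest) ->
    e (last w1 p1) w1 -> e (last w1 wr) (head (last w1 wr) p2) -> goal.
  move=> perm_ps; have := cps p1; have := cps p2.
  rewrite !(perm_mem perm_ps) !inE !eqxx orbT => /(_ isT) c2 /(_ isT) c1.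
  case: p1 p2 c1 c2 perm_ps => [|x p1] [|y p2] // c1 c2 perm_ps /= l1 h2.
  case/and3P: c1 => xA c1 _; case/and3P: c2 => _ c2 lB.
  apply: (finish _ _ (x :: p1 ++ ws ++ y :: p2) perm_ps) => //.
    by rewrite Ews /= xA !(cat_path, last_cat) /= cat_path c1 l1 pws /= h2 c2 last_cat.
  by rewrite /= cats0 -!cat_cons perm_catCA.
have perm_p := perm_to_rem pps.
have [Epq|neq_pq] := eqVneq q p; last first.
  have qrem : q \in rem p ps by rewrite rem_mem.
  apply: (two p q (rem q (rem p ps))) => //.
  by rewrite (permPl perm_p) /= perm_cons perm_to_rem.
rewrite {}Epq {q qps} in hq.
case Erem: (rem p ps) => [|p1 [|p2 rest]] in perm_p.
- by have := perm_size perm_p => /=; move: size_ps0; case: (size ps) => [|[|[]]].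
- by have := perm_size perm_p => /=; move: size_ps0; case: (size ps) => [|[|[]]].
have swap t t' (u : seq (seq V)) : perm_eq [:: t, t' & u] [:: t', t & u].
  by apply/permPl; exact: (perm_catCA [:: t] [:: t'] u).
have perm_p' : perm_eq ps [:: p, p2, p1 & rest].
  by rewrite (permPl perm_p) perm_cons swap.
have p1ps : p1 \in ps by rewrite (perm_mem perm_p) !inE eqxx !orbT.
have p2ps : p2 \in ps by rewrite (perm_mem perm_p) !inE eqxx !orbT.
(* Now [p] serves both as entry and as exit. If [p1] or [p2] can take over one of these roles, [two]
   finishes. *)
have [h1|h1] := boolP (e (last w1 wr) (head (last w1 wr) p1)); first exact: (two p p1 _ perm_p).
have [h2|h2] := boolP (e (last w1 wr) (head (last w1 wr) p2)); first exact: (two p p2 _ perm_p').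
have perm_12 t t' rest' : perm_eq ps [:: t, t' & rest'] -> perm_eq ps [:: t', t & rest'].
  by move/permPl->; apply: swap.
have [l1|l1] := boolP (e (last w1 p1) w1); first exact: (two p1 p _ (perm_12 _ _ _ perm_p)).
have [l2|l2] := boolP (e (last w1 p2) w1); first exact: (two p2 p _ (perm_12 _ _ _ perm_p')).
have w1h t : t \in ps -> ~~ e (last w1 t) w1 -> e w1 (head w1 t).
  move=> tps nlt; case: t tps nlt (cps t tps) => // x t tps nlt _ /=.
  have xw1 : x != w1 by apply: contraTneq (notin _ _ tps w1ws) => ->; rewrite mem_head.
  by apply: tour_or => //; apply: contra nlt => /(lastW _ _ _ tps w1ws); apply; rewrite mem_head.
have {l1} l1 := w1h _ p1ps l1; have {l2 w1h} l2 := w1h _ p2ps l2.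
have c1 := cps _ p1ps; have c2 := cps _ p2ps; have c := cps _ pps.
case: p lp hq perm_p perm_p' pps Erem c => [|z p] // lp hq perm_p perm_p' pps Erem c.
case: p1 p1ps h1 l1 perm_p perm_p' Erem c1 => [|x p1] // p1ps h1 l1 perm_p perm_p' Erem c1.
case: p2 p2ps h2 l2 perm_p perm_p' Erem c2 => [|y p2] // p2ps h2 l2 perm_p perm_p' Erem c2.
rewrite /= in lp hq h1 h2 l1 l2.
have neqx w : w \in ws -> w != x.
  by move/(notin _ _ p1ps); apply: contraNneq => ->; rewrite mem_head.
have neqy w : w \in ws -> w != y.
  by move/(notin _ _ p2ps); apply: contraNneq => ->; rewrite mem_head.
(* [w1] dominates both heads [x] and [y], while [x] dominates the end of [ws]. So [ws] has a first
   vertex [w] dominated by [x] or [y], it is not [w1], and its predecessor dominates both heads. *)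
have has_w : has (fun w => e x w || e y w) ws.
  by apply/hasP; exists (last w1 wr) => //; rewrite (tour_or (neqx _ wlws) h1).
have [s1 [w [s2 [Esplit xyw ns1]]]] : exists s1 w s2,
    [/\ ws = rcons s1 w ++ s2, e x w || e y w & ~~ has (fun w => e x w || e y w) s1].
  by case/split_find: has_w => w s1 s2 xyw ns1; exists s1, w, s2.
have w_ws : w \in ws by rewrite Esplit mem_cat mem_rcons mem_head.
case: s1 => [|w1' s1] in Esplit ns1.
  move: Esplit xyw; rewrite Ews => -[<- _].
  by case/orP => [/(tour_asym l1)|/(tour_asym l2)].
move: Esplit; rewrite Ews => -[Ew1 Ewr]; rewrite -{w1'}Ew1 in ns1.
have vws : last w1 s1 \in ws.
  by rewrite Ews Ewr -cat_cons -rcons_cons mem_cat mem_rcons in_cons mem_last orbT.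
have /norP[nxv nyv] : ~~ (e x (last w1 s1) || e y (last w1 s1)).
  by move/hasPn: ns1; apply; apply: mem_last.
have {nxv} evx : e (last w1 s1) x by apply: tour_or nxv; rewrite eq_sym neqx.
have {nyv} evy : e (last w1 s1) y by apply: tour_or nyv; rewrite eq_sym neqy.
have [ps1 ps2] : path e w1 s1 /\ path e w s2.
  by move: pws; rewrite Ewr cat_rcons cat_path /= => /and3P[].
have lws : last w s2 = last w1 wr by rewrite Ewr last_cat last_rcons.
(* With [ws] cut just before [w], the two halves change places around [z :: p]. The primed names
   allow either head to be the one dominating [w]. *)
have three x' p1' y' p2' rest' : perm_eq ps [:: z :: p, x' :: p1', y' :: p2' & rest'] ->
    x' :: p1' \in ps -> chain e A B (x' :: p1') -> chain e A B (y' :: p2') ->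
    e x' w -> e (last w1 s1) y' -> goal.
  move=> perm_ps p1ps' c1' c2' ex'w evy'.
  have elw : e (last x' p1') w by apply: (lastW _ _ _ p1ps' w_ws _ ex'w); rewrite mem_head.
  case/and3P: c1' => xA' pp1 _; case/and3P: c2' => _ pp2 lB'; case/and3P: c => _ pp _.
  apply: (finish [:: z :: p; x' :: p1'; y' :: p2'] rest'
           ((x' :: p1') ++ (w :: s2) ++ (z :: p) ++ (w1 :: s1) ++ (y' :: p2'))) => //.
    do 5!rewrite /= ?(cat_path, last_cat).
    by rewrite xA' pp1 elw ps2 lws hq pp lp ps1 evy' pp2 lB'.
  rewrite Ews Ewr cat_rcons /= cats0.
  have shuffle (P1 S2 P S1 P2 : seq V) :
      perm_eq (P1 ++ S2 ++ P ++ S1 ++ P2) ((S1 ++ S2) ++ P ++ P1 ++ P2).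
    by apply/permP => f; rewrite !count_cat; clear; lia.
  exact: (shuffle (x' :: p1') (w :: s2) (z :: p) (w1 :: s1) (y' :: p2')).

case/orP: xyw => ew; first exact: (three x p1 y p2 rest).
exact: (three y p2 x p1 rest).
Qed.
End Tournament.
End Linkages.

(** * From linkages to containers *)

Lemma path_exit (T : eqType) (e : rel T) (C : {pred T}) x p :
    path e x p -> x \in C -> last x p \notin C ->
  exists a b, [/\ a \in C, b \notin C, a \in x :: p, b \in x :: p & e a b].
Proof.
elim: p x => [|y p IH] x /=; first by move=> _ ->.
case/andP=> exy pp xC lC; have [yC|yC] := boolP (y \in C).
  have [a [b [aC bC ap bp eab]]] := IH y pp yC lC.
  by exists a, b; split; rewrite // inE ?ap ?bp orbT.
by exists x, y; rewrite !inE !eqxx orbT.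
Qed.

Lemma strong_exit (T : finType) (e : rel T) m (S : {set T}) (C : {pred T}) x y :
    m_strong e m -> #|S| < m -> x \in C -> y \notin C -> x \notin S -> y \notin S ->
  exists a b, [/\ a \in C, b \notin C, a \notin S, b \notin S & e a b].
Proof.
case=> _ strong ltS xC yC xS yS.
have [p /andP[/and3P[pp /eqP lp _] /allP pS]] := strong S ltS x y xS yS.
have [|a [b [aC bC ap bp eab]]] := path_exit pp xC _; first by rewrite lp.
by exists a, b; split; rewrite ?pS.
Qed.

Lemma uniq_flatten_nth (T : eqType) (ps : seq (seq T)) z i j :
  uniq (flatten ps) -> z \in nth [::] ps i -> z \in nth [::] ps j -> i = j.
Proof.
have memf (qs : seq (seq T)) n : z \in nth [::] qs n -> z \in flatten qs.
  have [lt_n zn|le_n] := ltnP n (size qs); last by rewrite nth_default.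
  by apply/flattenP; exists (nth [::] qs n); rewrite ?mem_nth.
elim: ps i j => [|p ps IH] [|i] [|j] //=; rewrite cat_uniq => /and3P[_ /hasPn np ups].
- by move=> zp /memf/np/negP.
- by move=> /memf/np/negP + zp.
- by move=> zi zj; rewrite (IH i j).
Qed.

Lemma container_along_arc (T : finType) (e : rel T) k u v :
    2 <= k -> is_tournament e -> m_strong e (2 * k + 1) -> e u v ->
  container_from e k.+1 u v.
Proof.
move=> k2 tour strong euv.
have neq_uv : u != v by apply: contraTneq euv => ->; case: tour.
pose V : finType := {z : T | (z != u) && (z != v)}.
pose eV (a b : V) := e (val a) (val b).
have inV t : t != u -> t != v -> exists z : V, val z = t.
  by move=> tu tv; exists (exist _ t (introT andP (conj tu tv))).
have Vu (z : V) : val z != u by case/andP: (valP z).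
have Vv (z : V) : val z != v by case/andP: (valP z).
have tourV : is_tournament eV.
  by case: tour => irr tot; split=> [z|a b ab]; [exact: irr | apply: tot; rewrite val_eqE].
pose X := [set z : V | e u (val z)]; pose Y := [set z : V | e (val z) v].
have memV (Z : {set V}) (z : V) : (val z \in val @: Z) = (z \in Z).
  by rewrite mem_imset //; apply: val_inj.
have uV (Z : {set V}) : u \notin val @: Z.
  by apply/imsetP => -[z _ Eu]; have := Vu z; rewrite -Eu eqxx.
have vV (Z : {set V}) : v \notin val @: Z.
  by apply/imsetP => -[z _ Ev]; have := Vv z; rewrite -Ev eqxx.
(* After deleting [v], a path from [u] enters [Z], by an arc not starting at [u] because [Z] avoids
   [X]. *)
have cutX (Z : {set V}) : Z != set0 -> (forall z, z \in Z -> z \notin X) ->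
    exists a b, [/\ a \notin Z, b \in Z & eV a b].
  case/set0Pn=> z zZ ZX.
  have [|||||a [b []]] := @strong_exit _ e _ [set v] [predC val @: Z] u (val z) strong.
  - by rewrite cards1; lia.
  - by rewrite !inE uV.
  - by rewrite !inE negbK memV.
  - by rewrite inE.
  - by rewrite inE.
  rewrite !inE negbK => aZ /imsetP[{}b bZ ->] av _ eab.
  have au : a != u by apply: contraTneq eab => ->; have := ZX b bZ; rewrite inE.
  by have [c Ec] := inV a au av; exists c, b; rewrite -(memV Z c) /eV Ec.
have cutY (Z : {set V}) : Z != set0 -> (forall z, z \in Z -> z \notin Y) ->
    exists a b, [/\ a \in Z, b \notin Z & eV a b].
  case/set0Pn=> z zZ ZY.
  have [|||||a [b []]] := @strong_exit _ e _ [set u] [pred t in val @: Z] (val z) v strong.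
  - by rewrite cards1; lia.
  - by rewrite inE memV.
  - by rewrite inE vV.
  - by rewrite inE.
  - by rewrite inE eq_sym.
  rewrite !inE => /imsetP[{}a aZ ->] bZ _ bu eab.
  have bv : b != v by apply: contraTneq eab => ->; have := ZY a aZ; rewrite inE.
  by have [c Ec] := inV b bu bv; exists a, c; rewrite -(memV Z c) /eV Ec.
have [|ps lps size_ps] := @menger V eV X Y (2 * k).
  move=> S /separatesP[C [XC dC clC]]; rewrite leqNgt; apply/negP => ltS.
  have ltSw w : #|w |: val @: S| < 2 * k + 1.
    apply: leq_ltn_trans (leq_card_setU _ _) _; rewrite cards1 card_imset; last exact: val_inj.
    by rewrite add1n addn1 ltnS.
  (* There are more than [2 * k + 1] vertices, so one lies outside [u], [v] and [S]. *)
  have /set0Pn[t] : ~: (u |: (v |: val @: S)) != set0.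
    rewrite -card_gt0 cardsCs setCK subn_gt0; case: strong => ltT _.
    apply: leq_ltn_trans ltT; rewrite cardsU1; have := ltSw v; case: (_ \notin _); lia.
  rewrite in_setC !in_setU1 => /norP[tu /norP[tv tS]].
  have [z Ez] := inV t tu tv; rewrite -{t tu tv}Ez memV in tS.
  (* Either a path from [z] to [v] avoiding [S] and [u] leaves [C], or a path from [u] to [z]
     avoiding [S] and [v] leaves [C] with [u] added. Both are impossible: [C] is closed, avoids [Y]
     and contains [X] outside [S]. *)
  have [zC|zC] := boolP (z \in C).
    have [||||a [b []]] := @strong_exit _ e _ (u |: val @: S)
      [pred t in val @: C] (val z) v strong (ltSw u).
    - by rewrite inE memV.
    - by rewrite inE vV.
    - by rewrite in_setU1 negb_or Vu memV.
    - by rewrite in_setU1 negb_or eq_sym neq_uv vV.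
    rewrite !inE => /imsetP[{}a aC ->] bC _ /norP[bu bS] eab.
    have bv : b != v.
      by apply: contraTneq eab => ->; have [+ _] := dC a aC; rewrite inE.
    have [c Ec] := inV b bu bv; move: bC bS eab; rewrite -Ec !memV => /negP + cS eac.
    by apply; apply: clC eac.
  have [||||a [b []]] := @strong_exit _ e _ (v |: val @: S)
      [pred t in u |: val @: C] u (val z) strong (ltSw v).
  - by rewrite !inE eqxx.
  - by rewrite !inE negb_or Vu memV.
  - by rewrite in_setU1 negb_or neq_uv uV.
  - by rewrite in_setU1 negb_or Vv memV.
  rewrite !inE => aC /norP[bu bC] _ /norP[bv bS] eab.
  have [c Ec] := inV b bu bv; move: bC bS eab; rewrite -Ec !memV => /negP cC cS eac; case: cC.
  case/predU1P: aC eac => [->|/imsetP[{}a aC ->]] eac; last exact: clC eac.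
  by apply: XC; rewrite // inE.
(* Here [k2] is used twice: [2 * k] exceeds 2, and the remaining [2 * k - 2] chains are at least
   [k]. *)
have [|qs [lqs size_qs _ covq]] := spanning_linkage tourV cutX cutY lps.
  by rewrite size_ps; lia.
have [|rs [lrs size_rs perm_rs]] := linkage_reduce (m := k) tourV lqs.
  by rewrite size_ps in size_qs; lia.
have covr z : z \in flatten rs by rewrite (perm_mem perm_rs).
case/andP: lrs => /allP crs urs.
(* Index 0 carries the empty list, so that its path is the arc from [u] to [v]; chains are nonempty,
   so no other index gives this path. *)
pose N i := nth [::] ([::] :: rs) i : seq V.
have NI i j z : z \in N i -> z \in N j -> i = j by apply: uniq_flatten_nth.
have N0 (i : 'I_k.+1) : N i = [::] -> i = ord0.
  case: i => -[|i] lt_i; rewrite /N /= => Ni; apply: val_inj => //=.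
  have : nth [::] rs i \in rs by rewrite mem_nth ?size_rs.
  by move/crs; rewrite Ni.
have intN i : interior (rcons (map val (N i)) v) = map val (N i).
  by rewrite /interior size_rcons -cats1 take_size_cat.
exists (fun i : 'I_k.+1 => rcons (map val (N i)) v); split.
- case=> -[|i] lt_i; rewrite /is_dipath /N /=; first by rewrite euv eqxx inE neq_uv.
  have rs_i : nth [::] rs i \in rs by rewrite mem_nth ?size_rs.
  have up := uniq_flatten_mem urs rs_i; have := crs _ rs_i.
  set p := nth _ _ _ in up *; move=> cp.
  have up' : u \notin map val p.
    by apply/mapP => -[z _ Eu]; have := Vu z; rewrite -Eu eqxx.
  have vp' : v \notin map val p.
    by apply/mapP => -[z _ Ev]; have := Vv z; rewrite -Ev eqxx.
  rewrite last_rcons eqxx rcons_uniq (map_inj_uniq val_inj) up vp' mem_rcons inE negb_or neq_uv up'.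
  rewrite rcons_path !andbT /=; case: p cp {up up' vp'} => // z q /and3P[+ pq +].
  by rewrite !inE /= path_map last_map => -> ->; rewrite -[path _ _ _]/(path eV z q) pq.
- move=> i j /= eqNij.
  have Nij : N i = N j by apply: (inj_map val_inj); apply: (@rcons_injl _ v).
  case ENi : (N i) => [|z r]; first by rewrite (N0 i) // (N0 j) // -Nij.
  by apply: val_inj; apply: (NI _ _ z); rewrite -?Nij ENi mem_head.
- move=> i j; rewrite !intN => neq_ij _ /mapP[z zi ->]; apply/mapP => -[z' zj /val_inj Ez].
  by case/eqP: neq_ij; apply: val_inj; apply: (NI _ _ z) => //; rewrite Ez.
move=> t; have [->|tu] := eqVneq t u; first by exists ord0; rewrite mem_head.
have [->|tv] := eqVneq t v; first by exists ord0; rewrite inE mem_rcons mem_head orbT.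
have [z <-] := inV t tu tv; have /flattenP[p prs zp] := covr z.
have lt_i : (index p rs).+1 < k.+1 by rewrite ltnS -size_rs index_mem.
exists (Ordinal lt_i); rewrite inE mem_rcons inE /N /= nth_index //.
by rewrite map_f ?orbT.
Qed.

Theorem theorem3p2 (T : finType) (e : rel T) (k : nat) :
  2 <= k -> is_tournament e -> m_strong e (2 * k + 1) ->
  every_arc_has_2bypass e ->
  k_star_strongly_connected e k.+1.
Proof.
move=> k2 tour strong _ u v neq_uv.
(* The container is directed along the arc between the two vertices. *)
have [euv|/(tour_or tour neq_uv) evu] := boolP (e u v); [left | right];
  exact: container_along_arc.
Qed.
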